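(* There exist a constant $c>0$ and infinitely many positive integers $n$ (all multiples of $4$) such that, with $d=n/4$, there is a layer family $\mathscr{Z}$ of dimension $2d$ on a symbol set of size $2n$ that satisfies endpoint count, strong adjacency and dimension reduction, and whose diameter is at least $c\,\dfrac{n^2}{\log n}$.
   Context: Let $X$ be a finite set of symbols and $D\ge 1$ an integer. Let $\mathcal{A}$ be a set of $D$-element subsets of $X$, and let $\mathcal{V}=\{V_0,\dots,V_t\}$ be a partition of $\mathcal{A}$ into nonempty, pairwise disjoint parts. A subset partition graph of dimension $D$ on $X$ is any simple connected graph $G$ whose vertex set is $\mathcal{V}$. Its diameter is the usual graph diameter. A layer family is a subset partition graph whose underlying graph is a path; its vertices, in path order, are called layers. Properties of $G$: - dimension reduction: for every $F\subseteq X$ with $|F|\le D-1$, the subgraph of $G$ induced on the vertices $V$ that contain some set $A\in V$ with $F\subseteq A$ is connected (the empty graph counts as connected); - adjacency: if $A,A'\in\mathcal{A}$ and $|A\cap A'|=D-1$, then $A$ and $A'$ lie in the same vertex or in adjacent vertices of $G$; - strong adjacency: $G$ satisfies adjacency and, whenever $V,V'$ are adjacent vertices of $G$, there are $A\in V$ and $A'\in V'$ with $|A\cap A'|=D-1$; - endpoint count: every $(D-1)$-subset $F$ of $X$ is contained in at most two sets $A\in\mathcal{A}$. *)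

(* Defs.v *)
From mathcomp Require Import all_boot.

Set Implicit Arguments.
Unset Strict Implicit.
Unset Printing Implicit Defensive.

Section Graph.
Variables (T : finType) (e : rel T).

Definition induced (S : {set T}) : rel T :=
  [rel x y | [&& x \in S, y \in S & e x y]].

Definition connected_on (S : {set T}) : Prop :=
  {in S &, forall x y, connect (induced S) x y}.

Definition walk (k : nat) (x y : T) : bool :=
  [exists p : k.-tuple T, path e x p && (last x p == y)].

(* A shortest walk has length < #|T|, so the search below finds the distance;
   the value is #|T| when there is no walk from x to y. *)
Definition gdist (x y : T) : nat := find (fun k => walk k x y) (iota 0 #|T|).

Definition diameter (S : {set T}) : nat :=
  \max_(x in S) \max_(y in S) gdist x y.

Definition is_path_graph (S : {set T}) : Prop :=
  exists s : seq T,
    [/\ uniq s, s =i S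
      & forall (x0 : T) (i j : nat), i < size s -> j < size s ->
          e (nth x0 s i) (nth x0 s j) = (j == i.+1) || (i == j.+1)].

End Graph.

(* The vertices of the graph are the elements of spg_parts; spg_adj is a
   relation on all sets of subsets of X, but holds only between parts. *)
Record subset_partition_graph (X : finType) (D : nat) := SubsetPartitionGraph {
  spg_sets : {set {set X}};
  spg_parts : {set {set {set X}}};
  spg_adj : rel {set {set X}};
  spg_dim_gt0 : 0 < D;
  spg_card : forall A, A \in spg_sets -> #|A| = D;
  spg_partition : partition spg_parts spg_sets;
  spg_parts_neq0 : spg_parts != set0;
  spg_adj_parts : forall V W, spg_adj V W ->
    (V \in spg_parts) && (W \in spg_parts);
  spg_adj_sym : symmetric spg_adj;
  spg_adj_irr : irreflexive spg_adj;
  spg_connected : connected_on spg_adj spg_parts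
}.

Section Properties.
Variables (X : finType) (D : nat) (G : subset_partition_graph X D).

Definition spg_diameter : nat := diameter (spg_adj G) (spg_parts G).

Definition layer_family : Prop := is_path_graph (spg_adj G) (spg_parts G).

Definition dimension_reduction : Prop :=
  forall F : {set X}, #|F| <= D.-1 ->
    connected_on (spg_adj G)
      [set V in spg_parts G | [exists A in V, F \subset A]].

Definition adjacency : Prop :=
  forall A A' : {set X}, A \in spg_sets G -> A' \in spg_sets G ->
    #|A :&: A'| = D.-1 ->
    exists V V' : {set {set X}},
      [/\ V \in spg_parts G, V' \in spg_parts G, A \in V, A' \in V'
        & V = V' \/ spg_adj G V V'].

Definition strong_adjacency : Prop :=
  adjacency /\
  forall V V' : {set {set X}}, spg_adj G V V' ->
    exists A A' : {set X}, [/\ A \in V, A' \in V' & #|A :&: A'| = D.-1].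

Definition endpoint_count : Prop :=
  forall F : {set X}, #|F| = D.-1 ->
    #|[set A in spg_sets G | F \subset A]| <= 2.

End Properties.

(* Main.v *)
Require Import Defs.
From mathcomp Require Import all_boot all_order all_algebra.
From mathcomp Require Import reals exp.
From mathcomp Require Import zify ring.

(** The family is obtained in two steps from sets of size [d] on a ground set
    with two sides of [2 * d] symbols each; here [n = 4 * d].

    The first step is a connected layer family in the spirit of Eisenbrand,
    Haehnle, Razborov and Rothvoss.  A [d]-set having [t] symbols on the first
    side goes to block [t./2], and each block is cut into [m] layers according
    to a colour of the set.  A set [F] of fewer than [d] symbols, [u] on the
    first side and [v] on the second, lies inside a [d]-set of block [q]
    exactly when [u <= 2 * q + 1] and [v <= d - 2 * q], and these [q] form an
    interval.  If every set of [d.-1] symbols sees all [m] colours among its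
    one-point extensions on either side, then [F] is contained in a member of
    every layer of each of these blocks, so the layers in which [F] occurs are
    consecutive.  There are more than [d] such extensions and each [d]-set is
    an extension in only [d] ways, so for [m] of order [d / log d] a colouring
    of this kind exists by an argument of local-lemma type
    ([polychromatic_colouring]).  About [d] blocks of [m] layers give the
    announced length.  The colouring is moreover prescribed on the [d]-subsets
    of certain sets [simplex k] of size [d.+1], all of which are put in layer
    [k]; any two simplices share at most [d - 2] symbols, so a set of [d.-1]
    symbols loses at most two of its free extensions.

    The second step ([doubling]) replaces each set [T] by [T] times [bool].
    Doubled sets never meet in [2 * d - 1] points, which makes the endpoint
    count and adjacency hold trivially but destroys strong adjacency.
    To repair it, layer [k.+1] receives one connector: the doubled
    [simplex k] without two points that lie over different symbols.  It meets
    a doubled facet of [simplex k], which is in layer [k], in [2 * d - 1]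
    points.  Dimension reduction survives: a subset of the connector whose
    projection has at most [d] symbols already occurs in layer [k], because
    all [d]-subsets of [simplex k] are there, and a subset with a larger
    projection occurs nowhere else. *)

Set Implicit Arguments.
Unset Strict Implicit.
Unset Printing Implicit Defensive.

(** * Path graphs built from disjoint layers *)

Section LayerGraph.

Variables (X : finType) (D N : nat) (L : 'I_N -> {set {set X}}).
Hypotheses (D_gt0 : 0 < D) (N_gt0 : 0 < N).
Hypothesis L_card : forall i M, M \in L i -> #|M| = D.
Hypothesis L_neq0 : forall i, L i != set0.
Hypothesis L_disj : forall i j M, M \in L i -> M \in L j -> i = j.

Let sets : {set {set X}} := \bigcup_i L i.
Let parts : {set {set {set X}}} := [set L i | i : 'I_N].
Let adj : rel {set {set X}} := fun V W =>
  [exists i, exists j,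
     [&& V == L i, W == L j & (j == i.+1 :> nat) || (i == j.+1 :> nat)]].

Lemma layer_inj : injective L.
Proof.
move=> i j eqL; have /set0Pn [M Mi] := L_neq0 i.
by apply: (L_disj Mi); rewrite -eqL.
Qed.

Lemma adjE i j : adj (L i) (L j) = (j == i.+1 :> nat) || (i == j.+1 :> nat).
Proof.
apply/existsP/idP => [[i' /existsP[j' /and3P[/eqP/layer_inj<- /eqP/layer_inj<-]]] //|e].
by exists i; apply/existsP; exists j; rewrite !eqxx e.
Qed.

Lemma layer_sets_card M : M \in sets -> #|M| = D.
Proof. by case/bigcupP=> i _ /L_card. Qed.

Lemma layer_partition : partition parts sets.
Proof.
apply/and3P; split.
- by rewrite cover_imset.
- apply/trivIsetP => _ _ /imsetP[i _ ->] /imsetP[j _ ->] nij.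
  rewrite -setI_eq0; apply/eqP/setP => M; rewrite !inE; apply/negP => /andP[Mi Mj].
  by rewrite (L_disj Mi Mj) eqxx in nij.
- by apply/imsetP => -[i _ /esym/eqP]; apply/negP.
Qed.

Lemma layer_parts_neq0 : parts != set0.
Proof. by apply/set0Pn; exists (L (Ordinal N_gt0)); apply: imset_f. Qed.

Lemma layer_adj_parts V W : adj V W -> (V \in parts) && (W \in parts).
Proof. by case/existsP=> i /existsP[j /and3P[/eqP-> /eqP-> _]]; rewrite !imset_f. Qed.

Lemma layer_adj_sym : symmetric adj.
Proof.
move=> V W; apply/idP/idP => /existsP[i /existsP[j /and3P[/eqP-> /eqP-> e]]];
  by rewrite adjE orbC.
Qed.

Lemma layer_adj_irr : irreflexive adj.
Proof.
move=> V; apply/negbTE/negP; case/existsP=> i; case/existsP=> j.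
by case/and3P=> /eqP-> /eqP/layer_inj->; lia.
Qed.

(** Connectivity of an induced subgraph of a path is convexity of its set of
    indices; dimension reduction is reduced to this. *)
Lemma interval_connected (S : {set {set {set X}}}) :
  (forall i j k : 'I_N, i <= j <= k -> L i \in S -> L k \in S -> L j \in S) ->
  {subset S <= parts} -> connected_on adj S.
Proof.
move=> cvx Ssub V W VS WS.
have /imsetP[i _ eV] := Ssub _ VS; have /imsetP[j _ eW] := Ssub _ WS.
subst V W.
(* induction on the distance, walking upwards from the lower of the two layers *)
have up : forall n (i j : 'I_N), j = i + n :> nat -> L i \in S -> L j \in S ->
    connect (induced adj S) (L i) (L j).
  elim=> [|n IH] {VS WS}i {}j eij iS jS.
    by have -> : j = i by apply: val_inj; rewrite /= eij addn0.
  have lt : i + n < N by have := ltn_ord j; lia.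
  have kS : L (Ordinal lt) \in S by apply: (cvx i _ j) => //=; lia.
  apply: (connect_trans (IH i (Ordinal lt) _ iS kS)) => //.
  by apply: connect1; rewrite /induced /= kS jS adjE /=; lia.
have sym : symmetric (induced adj S).
  by move=> V W; rewrite /induced /= layer_adj_sym andbCA.
case: (leqP i j) => ij.
  by apply: (up (j - i)); rewrite ?subnKC.
rewrite (sym_connect_sym sym).
by apply: (up (i - j)); rewrite ?subnKC // ltnW.
Qed.

(** One step of a walk changes the index by one, hence the diameter bound. *)
Lemma walk_dist (i j : 'I_N) n : walk adj n (L i) (L j) -> j <= i + n.
Proof.
case/existsP=> p /andP[pth /eqP lst]; rewrite -(size_tuple p).
move: (tval p) pth lst => {}p; elim: p i => [|V p IH] i /=.
  by move=> _ /layer_inj->; rewrite addn0.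
case/andP=> iV; have /andP[_ /imsetP[k _ eV]] := layer_adj_parts iV.
rewrite {}eV in iV * => pth lst; move: iV; rewrite adjE => iV.
have := IH k pth lst; rewrite addnS -addSn => /leq_trans-> //.
by rewrite leq_add2r; case/orP: iV => /eqP-> //; rewrite leqW.
Qed.

Lemma layer_count : N <= #|{set {set X}}|.
Proof. by rewrite -[N in N <= _]card_ord; apply: (leq_card L layer_inj). Qed.

Definition layer_graph : subset_partition_graph X D :=
  SubsetPartitionGraph D_gt0 layer_sets_card layer_partition layer_parts_neq0
    layer_adj_parts layer_adj_sym layer_adj_irr
    (interval_connected (fun i j k _ _ _ => imset_f L (erefl true)) (fun _ => id)).

Lemma layer_graph_family : layer_family layer_graph.
Proof.
exists [seq L i | i <- enum 'I_N]; split.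
- by rewrite (map_inj_uniq layer_inj) enum_uniq.
- move=> V; apply/mapP/imsetP => -[i _ ->]; exists i => //; exact: mem_enum.
- move=> V0 i j; rewrite size_map size_enum_ord => iN jN.
  rewrite !(nth_map (Ordinal iN)) -?enumT ?size_enum_ord //.
  by rewrite -[LHS]/(adj _ _) adjE !nth_enum_ord.
Qed.

Lemma layer_graph_diameter : N.-1 <= spg_diameter layer_graph.
Proof.
have ltN : N.-1 < N by rewrite prednK.
pose V := L (Ordinal N_gt0); pose W := L (Ordinal ltN).
(* [gdist] defaults to the number of all vertex sets, which is at least [N];
   otherwise it is the length of an actual walk *)
have VW : N.-1 <= gdist adj V W.
  rewrite leqNgt; apply/negP; rewrite /gdist; set w := fun k => _ => short.
  have hasw : has w (iota 0 #|{set {set X}}|).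
    by rewrite has_find size_iota (leq_trans short) // (leq_trans (leq_pred N))
               ?layer_count.
  have := nth_find 0 hasw; rewrite nth_iota ?add0n; last first.
    by rewrite -[X in _ < X](size_iota 0) -has_find.
  by move/walk_dist => /=; rewrite !add0n leqNgt short.
apply: (leq_trans VW); rewrite /spg_diameter /diameter.
have Vp : V \in parts by apply: imset_f.
have Wp : W \in parts by apply: imset_f.
apply: leq_trans (leq_bigmax_cond _ Vp).
exact: (@leq_bigmax_cond _ (mem parts) (gdist adj V) W Wp).
Qed.

Lemma layer_graph_endpoint_count :
  (forall F : {set X}, #|F| = D.-1 ->
     exists M M' : {set X}, forall i K, K \in L i -> F \subset K -> K = M \/ K = M') ->
  endpoint_count layer_graph.
Proof.
move=> two F /two[M [M' MM']].
apply: leq_trans (_ : #|[set M; M']| <= 2); last by rewrite cards2; case: (_ != _).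
apply/subset_leq_card/subsetP => K; rewrite !inE => /andP[/bigcupP[i _ Ki] FK].
by apply/orP; case: (MM' i K Ki FK) => ->; rewrite eqxx; [left|right].
Qed.

Lemma layer_graph_strong_adjacency :
  (forall i j A B, A \in L i -> B \in L j -> #|A :&: B| = D.-1 ->
     j <= i.+1 /\ i <= j.+1) ->
  (forall i j : 'I_N, j = i.+1 :> nat ->
     exists A B : {set X}, [/\ A \in L i, B \in L j & #|A :&: B| = D.-1]) ->
  strong_adjacency layer_graph.
Proof.
move=> near cross; split.
  move=> A B /bigcupP[i _ Ai] /bigcupP[j _ Bj] /(near i j A B Ai Bj) ij.
  exists (L i), (L j); split=> //; try exact: imset_f.
  case: (eqVneq i j) => [->|nij]; [by left|right].
  by rewrite -[spg_adj _ _ _]/(adj _ _) adjE; move: nij; rewrite -val_eqE /=; lia.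
move=> V W VW.
have /andP[/imsetP[i _ eV] /imsetP[j _ eW]] := layer_adj_parts VW.
subst V W; move: VW; rewrite -[spg_adj _ _ _]/(adj _ _) adjE => /orP[] /eqP e;
  first exact: cross.
have [B [A [Bj Ai AB]]] := cross j i e.
by exists A, B; split=> //; rewrite setIC.
Qed.

Lemma layer_graph_dimension_reduction :
  (forall (F : {set X}) (i j k : 'I_N), #|F| <= D.-1 -> i <= j <= k ->
     (exists2 M, M \in L i & F \subset M) -> (exists2 M, M \in L k & F \subset M) ->
     exists2 M, M \in L j & F \subset M) ->
  dimension_reduction layer_graph.
Proof.
move=> cvx F cF; apply: interval_connected => [i j k ijk|V];
  last by rewrite !inE => /andP[].
rewrite !inE => /andP[_ /exists_inP iF] /andP[_ /exists_inP kF].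
by rewrite imset_f //=; apply/exists_inP; apply: cvx ijk iF kF.
Qed.
End LayerGraph.

(** * Doubling a family of layers *)

Section Doubling.

Variable S : finType.
Implicit Types (T V : {set S}) (F M : {set S * bool}).

Definition double (T : {set S}) : {set S * bool} := setX T [set: bool].
Definition shadow (F : {set S * bool}) : {set S} := [set z.1 | z in F].
(** Two arbitrary elements of [V], when [V] has at least two. *)
Definition marked (V : {set S}) : {set S} := [set z in take 2 (enum V)].
Definition connector (V : {set S}) : {set S * bool} :=
  double V :\: setX (marked V) [set true].

Lemma in_double T z : (z \in double T) = (z.1 \in T).
Proof. by case: z => a b; rewrite !inE andbT. Qed.

Lemma card_double T : #|double T| = 2 * #|T|.
Proof. by rewrite cardsX cardsT card_bool mulnC. Qed.

Lemma shadow_double F T : (F \subset double T) = (shadow F \subset T).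
Proof.
apply/subsetP/subsetP => [FT _ /imsetP[z zF ->]|FT z zF].
  by rewrite -in_double FT.
by rewrite in_double FT // imset_f.
Qed.

Lemma card_shadow F : #|F| <= 2 * #|shadow F|.
Proof. by rewrite -card_double subset_leq_card // shadow_double. Qed.

Lemma double_inj : injective double.
Proof.
by move=> T T' /setP e; apply/setP => a; have := e (a, true); rewrite !in_double.
Qed.

Lemma markedP V : 1 < #|V| ->
  exists a b, [/\ a \in V, b \in V, a != b & marked V = [set a; b]].
Proof.
move=> V2; have := enum_uniq (mem V); have := mem_enum (mem V).
rewrite /marked; move: V2; rewrite cardE; case: (enum V) => [|a [|b s]] //= _ eV.
rewrite inE negb_or => /andP[/andP[ab _] _]; exists a, b; split=> //.
- by have := eV a; rewrite !inE eqxx.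
- by have := eV b; rewrite !inE eqxx orbT.
- by rewrite take0; apply/setP => z; rewrite !inE.
Qed.

Lemma connector_sub V : connector V \subset double V.
Proof. exact: subsetDl. Qed.

Lemma shadow_connector V : shadow (connector V) = V.
Proof.
apply/eqP; rewrite eqEsubset -shadow_double connector_sub; apply/subsetP => z zV.
by apply/imsetP; exists (z, false) => //; rewrite !inE zV andbF.
Qed.

Lemma card_connector V : 1 < #|V| -> #|connector V| = 2 * #|V|.-1.
Proof.
case/markedP=> a [b [aV bV ab mV]].
rewrite cardsDS; last first.
  apply: setXS; last exact: subsetT.
  by rewrite mV; apply/subsetP => z; rewrite !inE => /orP[] /eqP->.
by rewrite card_double cardsX mV cards2 ab cards1; lia.
Qed.

Lemma connector_not_double V T : 1 < #|V| -> connector V <> double T.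
Proof.
case/markedP=> a [b [aV bV ab mV]] /setP; rewrite /connector mV => e.
have := e (a, true); have := e (a, false).
by rewrite !in_double !inE aV eqxx /= => <-.
Qed.

(** Removing one of the two marked symbols leaves a doubled facet that the
    connector misses in a single point, over the other marked symbol. *)
Lemma connector_facet V : 1 < #|V| ->
  exists2 a, a \in V & #|double (V :\ a) :&: connector V| = 2 * #|V|.-1 - 1.
Proof.
case/markedP=> a [b [aV bV ab mV]]; exists a => //.
have bVa : (b, true) \in double (V :\ a) by rewrite in_double !inE eq_sym ab.
suff -> : double (V :\ a) :&: connector V = double (V :\ a) :\ (b, true).
  have := cardsD1 (b, true) (double (V :\ a)); rewrite bVa card_double.
  by rewrite (cardsD1 a V) aV add1n /= => ->; rewrite subn1.
apply/setP => -[z c]; rewrite /connector mV !inE /= xpair_eqE.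
by case: (eqVneq z a) => [->|]; case: (z \in V); case: (eqVneq z b);
  case: c => //=; rewrite ?andbF.
Qed.

Lemma intermediate_subset (F V : {set S}) n : F \subset V -> #|F| <= n <= #|V| ->
  exists T : {set S}, [/\ F \subset T, T \subset V & #|T| = n].
Proof.
move=> FV /andP[Fn]; elim: n Fn => [|n IH] Fn nV.
  exists F; split=> //; lia.
case: (leqP #|F| n) => [{}Fn|nF]; last by exists F; split=> //; lia.
have [T [FT TV cT]] := IH Fn (ltnW nV).
have /subsetPn[a aV aT] : ~~ (V \subset T).
  by apply/negP => /subset_leq_card; lia.
exists (a |: T); split; last by rewrite cardsU1 aT cT.
  by apply: subset_trans FT (subsetUr _ _).
by rewrite subUset sub1set aV.
Qed.

Variables (d N : nat) (rank : {set S} -> nat) (U : nat -> {set S}).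
Hypotheses (d_gt0 : 0 < d) (N_gt0 : 0 < N).

Definition active (F : {set S}) (k : nat) : Prop :=
  exists T : {set S}, [/\ #|T| = d, rank T = k & F \subset T].

Hypothesis U_card : forall k, k < N -> #|U k| = d.+1.
Hypothesis U_rank : forall k T, k < N -> T \subset U k -> #|T| = d -> rank T = k.
Hypothesis active_convex : forall (F : {set S}) i j k, #|F| < d -> i <= j <= k -> k < N ->
  active F i -> active F k -> active F j.

(** The connector of [U k] is placed one layer above the [d]-subsets of [U k],
    so that it ties layer [k] to layer [k.+1]. *)
Definition doubled_layer (k : 'I_N) : {set {set S * bool}} :=
  [set double T | T in [set T : {set S} | (#|T| == d) && (rank T == k)]]
  :|: [set M | (0 < k) && (M == connector (U k.-1))].

Lemma doubled_layerP (k : 'I_N) M : reflect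
  ((exists T, [/\ #|T| = d, rank T = k & M = double T])
   \/ (0 < k /\ M = connector (U k.-1)))
  (M \in doubled_layer k).
Proof.
apply: (iffP setUP) => -[].
- by case/imsetP=> T; rewrite inE => /andP[/eqP cT /eqP rT] ->; left; exists T.
- by rewrite inE => /andP[k0 /eqP->]; right.
- by case=> T [cT rT ->]; left; apply: imset_f; rewrite inE cT rT !eqxx.
- by case=> k0 ->; right; rewrite inE k0 eqxx.
Qed.

Lemma pred_ord_lt (k : 'I_N) : k.-1 < N.
Proof. exact: leq_ltn_trans (leq_pred k) (ltn_ord k). Qed.

Lemma U_gt1 k : k < N -> 1 < #|U k|.
Proof. by move/U_card->. Qed.

(** A common [d]-subset would have to lie in both layers. *)
Lemma U_unique (F : {set S}) k l : k < N -> l < N -> d <= #|F| ->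
  F \subset U k -> F \subset U l -> k = l.
Proof.
move=> kN lN dF Fk Fl.
have [|T [_ TF cT]] := @intermediate_subset set0 F d (sub0set _); first by rewrite cards0.
by rewrite -(U_rank kN (subset_trans TF Fk) cT) (U_rank lN (subset_trans TF Fl) cT).
Qed.

(** The reason why a connector creates no gap for sets with a small shadow. *)
Lemma active_U (F : {set S}) k : k < N -> #|F| <= d -> F \subset U k -> active F k.
Proof.
move=> kN Fd FU; have [|T [FT TU cT]] := @intermediate_subset F (U k) d FU.
  by rewrite Fd U_card /=.
by exists T; split=> //; apply: U_rank.
Qed.

Lemma doubled_activeP (F : {set S * bool}) (k : 'I_N) M :
  M \in doubled_layer k -> F \subset M ->
  active (shadow F) k \/ (0 < k /\ shadow F \subset U k.-1).
Proof.
case/doubled_layerP=> [[T [cT rT ->]]|[k0 ->]] FM.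
  by left; exists T; rewrite -shadow_double.
by right; split=> //; rewrite -shadow_double (subset_trans FM) ?connector_sub.
Qed.

Lemma doubled_active (F : {set S * bool}) (k : 'I_N) : active (shadow F) k ->
  exists2 M, M \in doubled_layer k & F \subset M.
Proof.
case=> T [cT rT FT]; exists (double T); last by rewrite shadow_double.
by apply/doubled_layerP; left; exists T.
Qed.

Lemma big_active (F : {set S}) k : d <= #|F| -> active F k -> #|F| = d /\ rank F = k.
Proof.
move=> dF [T [cT rT FT]].
by have -> : F = T by apply/eqP; rewrite eqEcard FT cT.
Qed.

(** A set with a shadow of at least [d] symbols determines the [d]-set or the
    [U k] that contains the shadow, so it can only occur in two consecutive
    layers.  This settles adjacency, and dimension reduction for such sets. *)
Lemma big_near (F : {set S * bool}) (i j : 'I_N) A B : d <= #|shadow F| ->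
  A \in doubled_layer i -> F \subset A -> B \in doubled_layer j -> F \subset B ->
  j <= i.+1 /\ i <= j.+1.
Proof.
move=> dF Ai FA Bj FB; have := pred_ord_lt i; have := pred_ord_lt j.
case: (doubled_activeP Ai FA) => [/(big_active dF)[cF ri]|[i0 Fi]];
case: (doubled_activeP Bj FB) => [/(big_active dF)[cF' rj]|[j0 Fj]] lj li.
- lia.
- have := U_rank lj Fj cF; lia.
- have := U_rank li Fi cF'; lia.
- have := U_unique lj li dF Fj Fi; lia.
Qed.

Lemma doubled_disjoint i j M : M \in doubled_layer i -> M \in doubled_layer j -> i = j.
Proof.
have li := pred_ord_lt i; have lj := pred_ord_lt j.
move=> /doubled_layerP[[T [cT rT eT]]|[i0 eT]] /doubled_layerP[[T' [cT' rT' eT']]|[j0 eT']];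
  apply: val_inj => /=; rewrite eT in eT'.
- by rewrite -rT -rT' (double_inj eT').
- by case: (connector_not_double (U_gt1 lj) (esym eT')).
- by case: (connector_not_double (U_gt1 li) eT').
- have eU : U i.-1 = U j.-1 by rewrite -[LHS]shadow_connector eT' shadow_connector.
  have dU : d <= #|U i.-1| by rewrite U_card // leqnSn.
  have := U_unique li lj dU (subxx _); rewrite eU subxx => /(_ isT); lia.
Qed.

Lemma doubled_card i M : M \in doubled_layer i -> #|M| = 2 * d.
Proof.
case/doubled_layerP=> [[T [cT _ ->]]|[_ ->]]; first by rewrite card_double cT.
by rewrite card_connector ?U_gt1 ?U_card ?pred_ord_lt.
Qed.

Lemma doubled_facet (k : 'I_N) a : a \in U k -> double (U k :\ a) \in doubled_layer k.
Proof.
move=> aU; have cT : #|U k :\ a| = d.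
  by have := cardsD1 a (U k); rewrite aU U_card // add1n => -[].
by apply/doubled_layerP; left; exists (U k :\ a); rewrite (U_rank _ (subsetDl _ _)).
Qed.

Lemma doubled_neq0 i : doubled_layer i != set0.
Proof.
have /card_gt0P[a aU] : 0 < #|U i| by rewrite U_card.
by apply/set0Pn; exists (double (U i :\ a)); apply: doubled_facet.
Qed.

Theorem doubling : exists Z : subset_partition_graph (S * bool)%type (2 * d),
  [/\ layer_family Z, endpoint_count Z, strong_adjacency Z, dimension_reduction Z
    & N.-1 <= spg_diameter Z].
Proof.
have D_gt0 : 0 < 2 * d by rewrite muln_gt0.
exists (layer_graph D_gt0 N_gt0 doubled_card doubled_neq0 doubled_disjoint).
(* doubling at most doubles cardinals, so [2 * d - 1] points have [d] shadows *)
have big F : #|F| = (2 * d).-1 -> d <= #|shadow F|.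
  by have := card_shadow F; lia.
split.
- exact: layer_graph_family.
- apply: layer_graph_endpoint_count => F /big dF.
  have [k0 Fk0|no] := pickP [pred k : 'I_N | shadow F \subset U k].
    exists (double (shadow F)), (connector (U k0)).
    move=> i K /doubled_layerP[[T [cT _ ->]]|[i0 ->]] FK; [left|right].
      by congr double; apply/esym/eqP; rewrite eqEcard -shadow_double FK cT.
    congr (connector (U _)); apply: (U_unique _ _ dF); rewrite ?pred_ord_lt //.
    by rewrite -shadow_double (subset_trans FK) ?connector_sub.
  exists (double (shadow F)), (double (shadow F)).
  move=> i K /doubled_layerP[[T [cT _ ->]]|[i0 ->]] FK; left.
    by congr double; apply/esym/eqP; rewrite eqEcard -shadow_double FK cT.
  have /= := no (Ordinal (pred_ord_lt i)).
  by rewrite -shadow_double (subset_trans FK) ?connector_sub.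
- apply: layer_graph_strong_adjacency => [i j A B Ai Bj /big dF|i j ij].
    by apply: (big_near dF Ai _ Bj); rewrite ?subsetIl ?subsetIr.
  have [a aU cI] := connector_facet (U_gt1 (ltn_ord i)).
  exists (double (U i :\ a)), (connector (U i)); split.
  + exact: doubled_facet.
  + by apply/doubled_layerP; right; rewrite ij.
  + by rewrite cI U_card // subn1.
- apply: layer_graph_dimension_reduction => F i j k _ ijk [A Ai FA] [B Bk FB].
  case: (leqP d #|shadow F|) => [dF|Fd].
    have near := big_near dF Ai FA Bk FB.
    have [eji|ejk] : j = i \/ j = k.
      case: (ltnP i j) => ?; [right|left]; apply: val_inj => /=; lia.
    + by rewrite eji; exists A.
    + by rewrite ejk; exists B.
  case: (eqVneq j i) => [->|ji]; first by exists A.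
  case: (eqVneq j k) => [->|jk]; first by exists B.
  have {}ijk : i < j < k by move: ji jk; rewrite -!val_eqE /=; lia.
  (* a connector of layer k makes active only what is active in layer k.-1 *)
  have low (l : 'I_N) M : M \in doubled_layer l -> F \subset M ->
      active (shadow F) l \/ (0 < l /\ active (shadow F) l.-1).
    move=> Ml FM; have [|[l0 Fl]] := doubled_activeP Ml FM; first by left.
    by right; split=> //; apply: active_U (ltnW Fd) Fl; apply: pred_ord_lt.
  apply: doubled_active.
  have kN := ltn_ord k; have k1N := pred_ord_lt k.
  case: (low i A Ai FA) => [ai|[i0 ai]]; case: (low k B Bk FB) => [ak|[k0 ak]];
    by apply: (active_convex Fd _ _ ai ak); lia.
- exact: layer_graph_diameter.
Qed.

End Doubling.

(** * Polychromatic colourings of sparse hypergraphs *)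

(** The numerical core of the induction step below: the hypotheses are the
    probability that an edge of [a.+1] vertices avoids a colour, the growth
    bound used [a] times, and the size condition on the number of colours. *)
Lemma avoid_count_arith m K a B M' M : 0 < m ->
  m ^ a.+1 * B <= m.-1 ^ a.+1 * M' -> (2 * m - 1) ^ a * M' <= (2 * m) ^ a * M ->
  K * (2 * m - 2) ^ a <= (2 * m - 1) ^ a -> K * B <= M.
Proof.
move=> m_gt0; have -> : 2 * m - 2 = 2 * m.-1 by lia.
have z0 : 0 < (2 * m - 1) ^ a by rewrite expn_gt0; lia.
have x0 : 0 < m ^ a by rewrite expn_gt0 m_gt0.
rewrite !expnMn !expnS; move: x0 z0.
move: (m ^ a) (m.-1 ^ a) (2 ^ a) ((2 * m - 1) ^ a) => x y w z x0 z0 hB hM hK.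
have mxz : 0 < m * (x * z) by rewrite !muln_gt0 m_gt0 x0.
rewrite -(leq_pmul2l mxz).
have h1 := leq_mul (leqnn (K * z)) hB.
have h2 := leq_mul (leqnn (K * m.-1 * y)) hM.
have h3 := leq_mul (leqnn (m.-1 * x * M)) hK.
have h4 : m.-1 * x * M * z <= m * x * M * z by rewrite !leq_mul ?leq_pred.
move: (m.-1) h1 h2 h3 h4 => p h1 h2 h3 h4; nia.
Qed.

Section Polychromatic.

Variables (V : finType) (m : nat).
Implicit Types (f g : {ffun V -> 'I_m}) (Q : {set {ffun V -> 'I_m}}).
Implicit Types (e S A : {set V}) (v : V) (c : 'I_m).

Definition recolour f v c : {ffun V -> 'I_m} :=
  [ffun u => if u == v then c else f u].

Definition avoiding A c : {set {ffun V -> 'I_m}} :=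
  [set f : {ffun V -> 'I_m} | [forall v in A, f v != c]].

(** Recolouring [v] by [c] shows that, inside [Q], no colour of [v] is more
    frequent than [c]; so at least one colouring in [m] gives [v] colour [c]. *)
Lemma avoid_vertex Q v c :
  (forall f c', f \in Q -> recolour f v c' \in Q) ->
  m * #|[set f : {ffun V -> 'I_m} in Q | f v != c]| <= m.-1 * #|Q|.
Proof.
move=> Qv; pose q := #|[set f : {ffun V -> 'I_m} in Q | f v == c]|.
have le_q c' : #|[set f : {ffun V -> 'I_m} in Q | f v == c']| <= q.
  rewrite -(card_in_imset (f := fun f => recolour f v c)).
    apply/subset_leq_card/subsetP => _ /imsetP[f + ->].
    by rewrite !inE => /andP[fQ _]; rewrite Qv //= ffunE eqxx.
  move=> f g; rewrite !inE => /andP[_ /eqP fv] /andP[_ /eqP gv] /ffunP fg.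
  by apply/ffunP => u; have := fg u; rewrite !ffunE; case: eqP => // ->; rewrite fv gv.
have Q_le : #|Q| <= m * q.
  rewrite -sum1_card (partition_big (fun f : {ffun V -> 'I_m} => f v) xpredT) //=.
  have -> : m * q = \sum_(c' : 'I_m) q by rewrite sum_nat_const card_ord.
  by apply: leq_sum => c' _; rewrite sum1_card -cardsE; apply: le_q.
have QD : #|Q| = q + #|[set f : {ffun V -> 'I_m} in Q | f v != c]|.
  rewrite -(cardsID [set f : {ffun V -> 'I_m} | f v == c] Q); congr (_ + _);
    by apply: eq_card => f; rewrite !inE // andbC.
have m_gt0 : 0 < m by apply: leq_trans (ltn_ord c).
by move: Q_le; rewrite QD; move: {le_q QD}q (#|_|) => q r Q_le; nia.
Qed.

Lemma avoid_set Q A c :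
  (forall v f c', v \in A -> f \in Q -> recolour f v c' \in Q) ->
  m ^ #|A| * #|Q :&: avoiding A c| <= m.-1 ^ #|A| * #|Q|.
Proof.
move: {2}#|A| (erefl #|A|) => n; elim: n A => [|n IH] A cA QA.
  by rewrite cA !expn0 !mul1n subset_leq_card ?subsetIl.
have /card_gt0P[v vA] : 0 < #|A| by rewrite cA.
have cB : #|A :\ v| = n by have := cardsD1 v A; rewrite vA cA => -[].
have := IH _ cB (fun u f c' uB => QA u f c' (subsetP (subD1set A v) u uB)).
rewrite cA cB; set Q' := _ :&: _ => IHB.
have Qv f c' : f \in Q' -> recolour f v c' \in Q'.
  rewrite !inE => /andP[fQ /forall_inP fB]; rewrite QA //=.
  apply/forall_inP => u uB; rewrite ffunE; case: (eqVneq u v) => [uv|_]; last exact: fB.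
  by rewrite uv !inE eqxx in uB.
have -> : Q :&: avoiding A c = [set f : {ffun V -> 'I_m} in Q' | f v != c].
  apply/setP => f; rewrite !inE -andbA; congr (_ && _).
  apply/forall_inP/andP => [fA|[/forall_inP fB fv] u uA].
    by split; [apply/forall_inP => u; rewrite !inE => /andP[_ /fA]|apply: fA].
  by case: (eqVneq u v) => [->//|uv]; apply: fB; rewrite !inE uv.
rewrite !expnS -mulnA mulnCA.
apply: leq_trans (leq_mul (leqnn _) (avoid_vertex c Qv)) _.
by rewrite mulnCA -mulnA leq_mul.
Qed.

Variables (Delta s : nat) (E : {set {set V}}).
Hypothesis edge_size : forall e, e \in E -> s < #|e|.
Hypothesis degree : forall v, #|[set e in E | v \in e]| <= Delta.
Hypothesis few_colours :
  2 * Delta * m ^ 2 * (2 * m - 2) ^ s <= (2 * m - 1) ^ s.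
Hypothesis m_gt0 : 0 < m.

Definition polychromatic f e := [forall c, exists v in e, f v == c].

(** All colourings of [V] are counted, but only the edges inside [S] are
    tested; membership therefore does not depend on the colours outside [S]. *)
Definition good S : {set {ffun V -> 'I_m}} :=
  [set f : {ffun V -> 'I_m} | [forall e in E, (e \subset S) ==> polychromatic f e]].

Lemma goodS S S' : S' \subset S -> good S \subset good S'.
Proof.
move=> S'S; apply/subsetP => f; rewrite !inE => /forall_inP fS.
apply/forall_inP => e eE; apply/implyP => eS'.
by apply: (implyP (fS e eE)); apply: subset_trans eS' S'S.
Qed.

Lemma good_recolour S v f c : v \notin S -> f \in good S -> recolour f v c \in good S.
Proof.
move=> vS; rewrite !inE => /forall_inP fS; apply/forall_inP => e eE.
apply/implyP => eS; have /forallP fe := implyP (fS e eE) eS.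
apply/forallP => c'; have /exists_inP[u ue fu] := fe c'.
apply/exists_inP; exists u => //; rewrite ffunE; case: (eqVneq u v) => // uv.
by rewrite -uv (subsetP eS) in vS.
Qed.

(** The relative loss [1 / (2 * m)] conceded per vertex is half of the one,
    [1 / m], by which every vertex of an edge lowers the chance that the
    edge avoids a given colour; long edges therefore leave a margin. *)
Definition grows S :=
  forall v, v \notin S -> (2 * m - 1) * #|good S| <= 2 * m * #|good (v |: S)|.

(** Iterating the growth bound along the vertices of [S] outside [S']. *)
Lemma grows_chain n S S' : (forall T : {set V}, #|T| < n -> grows T) ->
  #|S| <= n -> S' \subset S ->
  (2 * m - 1) ^ #|S :\: S'| * #|good S'| <= (2 * m) ^ #|S :\: S'| * #|good S|.
Proof.
move=> gr; move: {2}#|_| (erefl #|S :\: S'|) => k; elim: k S => [|k IH] S cS Sn S'S.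
  rewrite cS !mul1n (_ : S = S') //; apply/eqP.
  by rewrite eqEsubset S'S andbT -setD_eq0 -cards_eq0 cS.
have /card_gt0P[v] : 0 < #|S :\: S'| by rewrite cS.
rewrite inE => /andP[vS' vS].
have cT : #|(S :\ v) :\: S'| = k.
  have := cardsD1 v (S :\: S'); rewrite !inE vS' vS cS add1n => -[->].
  by apply: eq_card => u; rewrite !inE andbCA.
have lt : #|S :\ v| < n by apply: leq_trans Sn; rewrite [in X in _ < X](cardsD1 v S) vS.
have S'T : S' \subset S :\ v by rewrite subsetD1 S'S.
have := gr _ lt v; rewrite !inE eqxx setD1K // => /(_ isT) step.
have := IH _ cT (ltnW lt) S'T; rewrite cT cS !expnS => le_k.
rewrite -mulnA (leq_trans (leq_mul (leqnn _) le_k)) // mulnCA [X in _ <= X]mulnAC.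
by rewrite mulnC leq_mul.
Qed.

(** Forgetting the vertices of [e] makes the event that [e] avoids [c]
    independent of the remaining conditions; the growth bound, applied to the
    vertices of [e] one by one, limits the loss due to forgetting. *)
Lemma missing_bound S v e c : (forall T : {set V}, #|T| < #|S| -> grows T) ->
  v \notin S -> e \in E -> v \in e -> e \subset v |: S ->
  2 * Delta * m ^ 2 * #|good S :&: avoiding e c| <= #|good S|.
Proof.
move=> gr vS eE ve eS.
have := grows_chain gr (leqnn _) (subsetDl S e).
have -> : S :\: (S :\: e) = e :\ v.
  apply/setP => u; rewrite !inE; have := subsetP eS u; rewrite !inE.
  case: (eqVneq u v) => [->|_]; first by rewrite (negbTE vS) andbF.
  by case: (u \in e) => [/(_ isT) /= -> //|_]; case: (u \in S).
have ce : #|e| = #|e :\ v|.+1 by have := cardsD1 v e; rewrite ve.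
have := edge_size eE; rewrite ce ltnS; set a := #|e :\ v| => sa.
have av : m ^ a.+1 * #|good (S :\: e) :&: avoiding e c|
       <= m.-1 ^ a.+1 * #|good (S :\: e)|.
  by rewrite -ce; apply: avoid_set => u f c' ue; apply: good_recolour; rewrite !inE ue.
have le_B : #|good S :&: avoiding e c| <= #|good (S :\: e) :&: avoiding e c|.
  by rewrite subset_leq_card // setSI // goodS // subsetDl.
move=> chain; apply: (leq_trans (leq_mul (leqnn _) le_B)).
apply: (avoid_count_arith m_gt0 av chain).
have m1 : 0 < 2 * m - 1 by lia.
rewrite -(subnKC sa) !expnD mulnA leq_mul //.
by case: (a - s) => [//|k]; rewrite leq_exp2r //; lia.
Qed.

Lemma weighted_union (I T : finType) (J : {set I}) (B : I -> {set T}) w M :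
  (forall i, i \in J -> w * #|B i| <= M) -> w * #|\bigcup_(i in J) B i| <= #|J| * M.
Proof.
move=> BM; rewrite -sum_nat_const.
elim/big_rec2: _ => [|i x A iJ le_x]; first by rewrite cards0 muln0.
apply: leq_trans (leq_add (BM i iJ) le_x).
by rewrite -mulnDr leq_mul // cardsU leq_subr.
Qed.

(** Strong induction on [S]: a colouring is lost only because some edge at [v]
    avoids some colour, there are at most [Delta * m] such events, and each one
    has relative frequency at most [1 / (2 * Delta * m ^ 2)]. *)
Lemma grows_all S : grows S.
Proof.
have [n] := ubnP #|S|; elim: n S => [//|n IH] S Sn v vS.
have gr (T : {set V}) : #|T| < #|S| -> grows T by move=> lt; apply: IH; lia.
pose J := setX [set e in E | v \in e] [set: 'I_m].
pose B (p : {set V} * 'I_m) :=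
  if p.1 \subset v |: S then good S :&: avoiding p.1 p.2 else set0.
have BM p : p \in J -> 2 * Delta * m ^ 2 * #|B p| <= #|good S|.
  rewrite !inE andbT => /andP[pE vp]; rewrite /B.
  case: ifP => pS; last by rewrite cards0 muln0.
  exact: (missing_bound p.2 gr vS pE vp pS).
have := weighted_union BM; set bad := \bigcup_(p in J) B p => bad_le.
have J_le : #|J| <= Delta * m by rewrite cardsX cardsT card_ord leq_mul ?degree.
have lost : #|good S| <= #|good (v |: S)| + #|bad|.
  rewrite -(cardsID (good (v |: S)) (good S)) leq_add ?subset_leq_card ?subsetIr //.
  apply/subsetP => f; rewrite inE => /andP[fN fS].
  have : f \notin [set f : {ffun V -> 'I_m} |
    [forall e in E, (e \subset v |: S) ==> polychromatic f e]] by [].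
  rewrite inE negb_forall_in => /exists_inP[e eE]; rewrite negb_imply => /andP[eS].
  rewrite negb_forall => /existsP[c]; rewrite negb_exists_in => ec.
  have ve : v \in e.
    apply: contraLR ec => ve; have /subsetP sub : e \subset S.
      apply/subsetP => u ue; have := subsetP eS u ue; rewrite !inE.
      by case: eqP => // uv; rewrite -uv ue in ve.
    move: fS; rewrite inE => /forall_inP/(_ e eE)/implyP/(_ (introT subsetP sub)).
    move/forallP/(_ c)/exists_inP=> [u ue fu].
    by apply/negP => /forall_inP/(_ u ue); rewrite fu.
  apply/bigcupP; exists (e, c); first by rewrite !inE eE ve.
  by rewrite /B /= eS !inE; move: fS; rewrite inE => ->.
have [D0|D0] := posnP Delta.
  have b0 : #|bad| = 0.
    apply/eqP; rewrite cards_eq0; apply/eqP/setP => f; rewrite inE.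
    apply/negP => /bigcupP[p pJ _].
    have : 0 < #|J| by apply/card_gt0P; exists p.
    by rewrite ltnNge (leq_trans J_le) // D0.
  by rewrite b0 addn0 in lost; rewrite leq_mul ?leq_subr.
move: (#|bad|) (#|J|) bad_le J_le lost => b j bad_le J_le.
move: (#|good S|) (#|good (v |: S)|) bad_le => g g' bad_le lost.
have : Delta * m * (2 * m * b) <= Delta * m * g.
  have -> : Delta * m * (2 * m * b) = 2 * Delta * m ^ 2 * b by lia.
  by rewrite (leq_trans bad_le) // leq_mul.
rewrite leq_pmul2l ?muln_gt0 ?D0 //; nia.
Qed.

(** No good colouring can be lost entirely, since [grows] preserves positivity
    up to the full vertex set. *)
Theorem polychromatic_colouring :
  exists f : {ffun V -> 'I_m}, forall e c, e \in E -> exists2 v, v \in e & f v = c.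
Proof.
have := grows_chain (fun T _ => @grows_all T) (leqnn _) (sub0set [set: V]).
have -> : good set0 = [set: {ffun V -> 'I_m}].
  apply/setP => f; rewrite !inE; apply/forall_inP => e eE; apply/implyP.
  by rewrite subset0 => /eqP e0; have := edge_size eE; rewrite e0 cards0.
have pos : 0 < (2 * m - 1) ^ #|[set: V] :\: set0| * #|[set: {ffun V -> 'I_m}]|.
  rewrite muln_gt0 expn_gt0 cardsT card_ffun card_ord expn_gt0 m_gt0 andbT; lia.
move/(leq_trans pos); rewrite muln_gt0 => /andP[_ /card_gt0P[f]].
rewrite inE => /forall_inP fE; exists f => e c eE.
have /forallP/(_ c)/exists_inP[v ve /eqP fv] := implyP (fE e eE) (subsetT e).
by exists v.
Qed.

End Polychromatic.

(** * The two-sided layer family *)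

Section TwoSided.

Variables d m b : nat.
Hypotheses (m_gt0 : 0 < m) (b_gt0 : 0 < b).
Hypothesis b_small : 2 * b + 1 <= d.
Hypothesis m_small : 6 * m <= d.

Let S := (bool * 'I_(2 * d))%type.
Let N := b * m.
Implicit Types (A F T W : {set S}) (x y z : S) (s : bool).

Definition side_card A s : nat := #|[set z in A | z.1 == s]|.

Lemma side_cardS A W s : A \subset W -> side_card A s <= side_card W s.
Proof.
by move=> /subsetP AW; apply/subset_leq_card/subsetP => z; rewrite !inE => /andP[/AW->].
Qed.

Lemma side_cardE A : #|A| = side_card A true + side_card A false.
Proof.
rewrite -(cardsID [set z : S | z.1] A); congr (_ + _);
  by apply: eq_card => -[[] z]; rewrite !inE /= ?andbT ?andbF ?orbF //.
Qed.

Lemma side_cardU1 A x s : x \notin A -> side_card (x |: A) s = (x.1 == s) + side_card A s.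
Proof.
move=> xA; rewrite /side_card; case: (eqVneq x.1 s) => [xs|xs].
  transitivity #|x |: [set z in A | z.1 == s]|.
    by apply: eq_card => z; rewrite !inE; case: (eqVneq z x) => [->|] //=; rewrite xs eqxx.
  by rewrite cardsU1 inE (negbTE xA).
apply: eq_card => z; rewrite !inE; case: (eqVneq z x) => [->|] //=.
by rewrite (negbTE xs) andbF.
Qed.

Lemma card_ord_interval n lo hi : hi <= n ->
  #|[set x : 'I_n | lo <= x < hi]| = hi - lo.
Proof.
move=> hin; rewrite -sum1_card; under eq_bigl do rewrite inE.
rewrite big_mkcond /=.
have -> : hi - lo = minn hi n - minn lo n by lia.
elim: {hin}n => [|n IH]; first by rewrite big_ord0; lia.
by rewrite big_ord_recr /= IH; case: (leqP hi n) => ?; case: (leqP lo n) => ? /=; lia.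
Qed.

Definition interval s lo hi : {set S} := [set z : S | (z.1 == s) && (lo <= z.2 < hi)].

Lemma card_interval s lo hi : hi <= 2 * d -> #|interval s lo hi| = hi - lo.
Proof.
move=> hid; transitivity #|setX [set s] [set x : 'I_(2 * d) | lo <= x < hi]|.
  by apply: eq_card => z; rewrite !inE.
by rewrite cardsX cards1 mul1n card_ord_interval.
Qed.

(** Position of the three symbols that tell apart the simplices of a block and
    of the next one; it lies beyond the initial intervals used below. *)
Definition code k : nat := d + 3 * (k %% (2 * m)).

(** For [k] in block [q = k %/ m], a set with [2 * q + 1] symbols on the first
    side and [d - 2 * q] on the second: all its facets belong to block [q].
    Simplices with different codes differ by the code triple; those with equal
    codes are at least two blocks apart, and then the initial intervals on the
    first side differ by at least four symbols. *)
Definition simplex k : {set S} :=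
  interval true 0 (2 * (k %/ m) + 1) :|:
  (interval false 0 (d - 2 * (k %/ m) - 3) :|: interval false (code k) (code k + 3)).

Lemma level_lt k : k < N -> k %/ m < b.
Proof. by move=> kN; rewrite ltn_divLR. Qed.

Lemma code_lt k : d <= code k /\ code k + 3 <= 2 * d.
Proof. have := @ltn_pmod k (2 * m); rewrite /code; lia. Qed.

Lemma simplex_side k : k < N ->
  side_card (simplex k) true = 2 * (k %/ m) + 1 /\
  side_card (simplex k) false = d - 2 * (k %/ m).
Proof.
move=> /level_lt; have [c1 c2] := code_lt k; rewrite /simplex.
move: (k %/ m) (code k) c1 c2 => q c c1 c2 qb; split.
  rewrite -[RHS]subn0 -(@card_interval true 0); last lia.
  by apply: eq_card => -[[] z]; rewrite !inE /= ?andbT ?andbF ?orbF //.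
transitivity (#|interval false 0 (d - 2 * q - 3)| + #|interval false c (c + 3)|);
  last by rewrite !card_interval; lia.
rewrite -cardsUI (_ : _ :&: _ = set0) ?cards0 ?addn0; last first.
  by apply/setP => z; rewrite !inE; case: (z.1 == false) => //=; lia.
by apply: eq_card => -[[] z]; rewrite !inE /= ?andbT ?andbF ?orbF //.
Qed.

Lemma card_simplex k : k < N -> #|simplex k| = d.+1.
Proof.
by move=> kN; rewrite side_cardE; have [-> ->] := simplex_side kN; have := level_lt kN; lia.
Qed.

Lemma simplex_far k l : k < N -> l < N -> k != l ->
  #|simplex k :&: simplex l| <= d - 2.
Proof.
have far s lo hi (i j : nat) : i < N -> hi <= 2 * d -> lo + 3 <= hi ->
    interval s lo hi \subset simplex i :\: simplex j ->
    #|simplex i :&: simplex j| <= d - 2.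
  move=> iN hid lohi /subset_leq_card; rewrite card_interval //.
  by have := cardsID (simplex j) (simplex i); rewrite card_simplex //; lia.
have climb (i j : nat) : i < N -> j < N -> 2 * (j %/ m) + 4 <= 2 * (i %/ m) + 1 ->
    #|simplex i :&: simplex j| <= d - 2.
  move=> iN jN ji; have ib := level_lt iN.
  apply: (far true (2 * (j %/ m) + 1) (2 * (i %/ m) + 1)) => //.
  - by move: (i %/ m) ib => p ib; lia.
  - by move: (i %/ m) (j %/ m) ji => p q; lia.
  rewrite /simplex; move: (i %/ m) (j %/ m) (code i) (code j) ji => p q u v ji.
  by apply/subsetP => -[[] z]; rewrite !inE //= ?orbF; clear -ji; lia.
move=> kN lN kl.
case: (eqVneq (k %% (2 * m)) (l %% (2 * m))) => [ekl|nkl]; last first.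
  have [c1 c2] := code_lt k; have [c3 c4] := code_lt l.
  have apart : code k + 3 <= code l \/ code l + 3 <= code k.
    by rewrite /code; move: (k %% _) (l %% _) nkl => u v; lia.
  apply: (far false (code k) (code k + 3)) => //; rewrite /simplex.
  move: (k %/ m) (l %/ m) (code k) (code l) c1 c2 c3 c4 apart => p q u v c1 c2 c3 c4 apart.
  by apply/subsetP => -[[] z]; rewrite !inE //=; clear -c1 c3 apart; lia.
have ek : k %/ m = 2 * (k %/ (2 * m)) + (k %% (2 * m)) %/ m.
  rewrite {1}(divn_eq k (2 * m)) mulnA divnMDl //; lia.
have el : l %/ m = 2 * (l %/ (2 * m)) + (l %% (2 * m)) %/ m.
  rewrite {1}(divn_eq l (2 * m)) mulnA divnMDl //; lia.
rewrite ekl in ek.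
have : k %/ (2 * m) != l %/ (2 * m).
  by apply: contraNneq kl => e; rewrite (divn_eq k (2 * m)) (divn_eq l (2 * m)) e ekl.
rewrite neq_ltn => /orP[lt|lt]; last by apply: climb => //; lia.
by rewrite setIC; apply: climb => //; lia.
Qed.

Lemma simplex_unique F k l : k < N -> l < N -> d.-1 <= #|F| ->
  F \subset simplex k -> F \subset simplex l -> k = l.
Proof.
move=> kN lN dF Fk Fl; apply/eqP; apply/negPn/negP => /(simplex_far kN lN).
have /subset_leq_card : F \subset simplex k :&: simplex l by rewrite subsetI Fk.
lia.
Qed.

(** The sets whose colour is prescribed. *)
Definition reserved : {set {set S}} :=
  [set T : {set S} | [exists k : 'I_N, T \subset simplex k]].

Definition star F s : {set {set S}} :=
  [set x |: F | x in [set x : S | x \notin F & x.1 == s]].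

Definition free_star (p : {set S} * bool) : {set {set S}} := star p.1 p.2 :\: reserved.

Definition free_stars : {set {set {set S}}} :=
  [set free_star p | p in [set p : {set S} * bool | #|p.1| == d.-1]].

Lemma insert_inj F : {in [set x | x \notin F] &, injective (fun x => x |: F)}.
Proof.
move=> x y; rewrite !inE => xF _ /setP/(_ x); rewrite !inE eqxx (negbTE xF) !orbF.
by move/esym/eqP.
Qed.

(** At least [d + 1] extensions on one side, and at most two of them reserved:
    a set of [d.-1] symbols lies in at most one simplex, and has two symbols
    left there. *)
Lemma free_star_size (p : {set S} * bool) : #|p.1| = d.-1 -> d - 2 < #|free_star p|.
Proof.
case: p => F s /= cF; rewrite /free_star /=.
have outside : d + 1 <= #|[set x : S | x \notin F & x.1 == s]|.
  have := cardsID F (interval s 0 (2 * d)); rewrite card_interval // subn0.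
  have : #|interval s 0 (2 * d) :&: F| <= d.-1 by rewrite -cF subset_leq_card ?subsetIr.
  have -> : interval s 0 (2 * d) :\: F = [set x : S | x \notin F & x.1 == s].
    by apply/setP => x; rewrite !inE ltn_ord leq0n !andbT.
  by move: (#|_|) (#|_|) => u v; lia.
have star_size : d + 1 <= #|star F s|.
  rewrite card_in_imset // => x y; rewrite !inE => /andP[xF _] /andP[yF _].
  by apply: insert_inj; rewrite inE.
suff lost : #|star F s :&: reserved| <= 2.
  move: lost star_size; rewrite -(cardsID reserved (star F s)).
  by move: (#|_|) (#|_|) => u v; lia.
have [k0 /= Fk0|no] := pickP [pred k : 'I_N | F \subset simplex k]; last first.
  rewrite (_ : _ :&: _ = set0) ?cards0 //; apply/setP => T; rewrite !inE.
  apply/negP => /andP[/imsetP[x _ ->] /existsP[k]]; rewrite subUset => /andP[_ Fk].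
  by have := no k; rewrite /= Fk.
have c2 : #|simplex k0 :\: F| = 2.
  by rewrite cardsDS // card_simplex // cF; lia.
apply: leq_trans (eq_leq c2).
apply: leq_trans (leq_imset_card (fun x => x |: F) _).
apply/subset_leq_card/subsetP => T; rewrite !inE => /andP[/imsetP[x]].
rewrite inE => /andP[xF _] -> /existsP[k]; rewrite subUset sub1set => /andP[xk Fk].
apply: imset_f; rewrite inE xF /=.
by rewrite (@simplex_unique F k0 k) // cF.
Qed.

(** An extension [T] of [F] on the side [s] is recovered from the symbol that
    was added, for which there are [d] choices. *)
Lemma free_stars_degree T : #|[set e in free_stars | T \in e]| <= d.
Proof.
have d_gt0 : 0 < d by lia.
case: (eqVneq #|T| d) => [cT|cT].
  apply: leq_trans (eq_leq cT).
  apply: leq_trans (leq_imset_card (fun x => free_star (T :\ x, x.1)) _).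
  apply/subset_leq_card/subsetP => e; rewrite inE => /andP[/imsetP[[F s] _ ->]].
  rewrite inE => /andP[_ /imsetP[x]]; rewrite inE => /andP[xF /= /eqP <-] ->.
  by apply/imsetP; exists x; rewrite ?setU11 // setU1K.
rewrite (_ : [set _ in _ | _] = set0) ?cards0 //; apply/setP => e; rewrite !inE.
apply/negP => /andP[/imsetP[[F s]]]; rewrite inE => /eqP /= cF ->.
rewrite inE => /andP[_ /imsetP[x]]; rewrite inE => /andP[xF _] eT.
by move: cT; rewrite eT cardsU1 xF cF add1n prednK ?eqxx.
Qed.

Definition colours_well (colour : {set S} -> nat) : Prop :=
  [/\ forall T, colour T < m,
      forall k T, k < N -> T \subset simplex k -> #|T| = d -> colour T = k %% m
    & forall F s c, #|F| = d.-1 -> c < m ->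
        exists x, [/\ x \notin F, x.1 = s & colour (x |: F) = c]].

Lemma colouring_exists :
  2 * d * m ^ 2 * (2 * m - 2) ^ (d - 2) <= (2 * m - 1) ^ (d - 2) ->
  exists colour, colours_well colour.
Proof.
move=> few_colours; have size_e e : e \in free_stars -> d - 2 < #|e|.
  by case/imsetP=> p; rewrite inE => /eqP cp ->; apply: free_star_size.
have [f fP] := polychromatic_colouring size_e free_stars_degree few_colours m_gt0.
exists (fun T =>
  if [pick k : 'I_N | T \subset simplex k] is Some k then k %% m else f T).
split=> [T|k T kN Tk cT|F s c cF cm].
- by case: pickP => [k _|_]; rewrite ?ltn_pmod.
- case: pickP => [l Tl|/(_ (Ordinal kN))]; last by rewrite /= Tk.
  by rewrite (simplex_unique (ltn_ord l) kN _ Tl Tk) // cT leq_pred.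
have eE : free_star (F, s) \in free_stars by apply: imset_f; rewrite inE cF.
have [T] := fP _ (Ordinal cm) eE.
rewrite !inE negb_exists => /andP[/forallP Tfree /imsetP[x]].
rewrite inE => /andP[xF /= /eqP xs] eT fT; exists x; split=> //.
case: pickP => [k|_]; first by rewrite -eT; move/negP: (Tfree k).
by rewrite -eT fT.
Qed.

Variable colour : {set S} -> nat.
Hypothesis colourP : colours_well colour.

Definition level T : nat := (side_card T true)./2 * m + colour T.

Lemma level_div T : level T %/ m = (side_card T true)./2.
Proof. by have [lt _ _] := colourP; rewrite divnMDl // divn_small ?addn0. Qed.

(** Half of the number of symbols on the first side is the same for all facets
    of a simplex: that number is [2 * q] or [2 * q + 1]. *)
Lemma level_simplex k T : k < N -> T \subset simplex k -> #|T| = d -> level T = k.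
Proof.
move=> kN Tk cT; have [_ col _] := colourP; rewrite /level (col k) // [RHS](divn_eq k m).
congr (_ * m + _).
have [ct cf] := simplex_side kN; have := level_lt kN.
have := side_cardS true Tk; have := side_cardS false Tk; rewrite ct cf.
by have := side_cardE T; rewrite cT; lia.
Qed.

(** [F] is extended to a [d]-set [T] of block [q]; exchanging one added symbol
    of [T] for another one on the same side stays in the block and reaches any
    prescribed colour. *)
Lemma active_all F q c : 2 * q + 1 <= d -> c < m -> #|F| < d ->
  side_card F true <= 2 * q + 1 -> side_card F false <= d - 2 * q ->
  active d level F (q * m + c).
Proof.
move=> qd cm Fd Ft Ff.
pose half s := interval s 0 (2 * d).
have half_card s : #|half s| = 2 * d by rewrite card_interval ?subn0.
have side_half A s : A :&: half s = [set z in A | z.1 == s].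
  by apply/setP => z; rewrite !inE ltn_ord leq0n !andbT.
have fill s n : side_card F s <= n <= 2 * d ->
    exists W, [/\ F :&: half s \subset W, W \subset half s & #|W| = n].
  by move=> ?; apply: intermediate_subset; rewrite ?subsetIr // half_card side_half.
(* sides filled up to the size of a simplex of block [q] *)
have [|W1 [FW1 hW1 cW1]] := fill true (2 * q + 1); first by rewrite Ft; lia.
have [|W0 [FW0 hW0 cW0]] := fill false (d - 2 * q); first by rewrite Ff; lia.
have sideW : side_card (W1 :|: W0) true = 2 * q + 1 /\
             side_card (W1 :|: W0) false = d - 2 * q.
  have in1 z : (z \in W1) ==> z.1.
    by apply/implyP => /(subsetP hW1); rewrite !inE => /andP[/eqP->].
  have in0 z : (z \in W0) ==> ~~ z.1.
    by apply/implyP => /(subsetP hW0); rewrite !inE => /andP[/eqP->].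
  rewrite -cW1 -cW0; split; apply: eq_card => z; move: (in1 z) (in0 z); rewrite !inE;
    by case: (z \in W1); case: (z \in W0); case: z.1.
have FW : F \subset W1 :|: W0.
  apply/subsetP => z zF; rewrite inE; case ez : z.1; [|apply/orP; right].
    by rewrite (subsetP FW1) // !inE zF ez ltn_ord.
  by rewrite (subsetP FW0) // !inE zF ez ltn_ord.
have cW : #|W1 :|: W0| = d.+1 by rewrite side_cardE; have [-> ->] := sideW; lia.
have [|T [FT TW cT]] := @intermediate_subset _ F (W1 :|: W0) d FW; first by rewrite cW; lia.
have [x xT xF] : exists2 x, x \in T & x \notin F.
  by apply/subsetPn/negP => /subset_leq_card; lia.
have [_ _ poly] := colourP.
have cTx : #|T :\ x| = d.-1 by rewrite -[in RHS]cT (cardsD1 x T) xT.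
have [y [yT yx cy]] := poly (T :\ x) x.1 c cTx cm.
exists (y |: T :\ x); split.
- by rewrite cardsU1 yT cTx add1n prednK // (leq_ltn_trans _ Fd).
- rewrite /level cy; congr (_ * m + _).
  rewrite side_cardU1 // yx -(side_cardU1 _ (negbT (setD11 x T))) setD1K //.
  have := side_cardS true TW; have := side_cardS false TW; have [-> ->] := sideW.
  have := side_cardE T; rewrite cT.
  by move: (side_card T true) (side_card T false); clear -qd => u v; lia.
- apply: subset_trans (subsetUr _ _); rewrite subsetD1 FT //.
Qed.

(** The lower layer bounds the first side of [F], the upper one its second
    side; both bounds persist in between. *)
Lemma level_convex F i j k : #|F| < d -> i <= j <= k -> k < N ->
  active d level F i -> active d level F k -> active d level F j.
Proof.
move=> Fd /andP[ij jk] kN [T [cT rT FT]] [T' [cT' rT' FT']].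
have qi := level_div T; have qk := level_div T'; rewrite rT in qi; rewrite rT' in qk.
have ij' := leq_div2r m ij; have jk' := leq_div2r m jk; have kb := level_lt kN.
rewrite (divn_eq j m); apply: active_all => //; first 1 last.
- exact: ltn_pmod.
- by have := side_cardS true FT; lia.
- by have := side_cardS false FT'; have := side_cardE T'; lia.
- lia.
Qed.

End TwoSided.

Theorem long_layer_family d m b : 0 < m -> 0 < b -> 2 * b + 1 <= d -> 6 * m <= d ->
  2 * d * m ^ 2 * (2 * m - 2) ^ (d - 2) <= (2 * m - 1) ^ (d - 2) ->
  exists Z : subset_partition_graph ((bool * 'I_(2 * d)) * bool)%type (2 * d),
  [/\ layer_family Z, endpoint_count Z, strong_adjacency Z, dimension_reduction Z
    & (b * m).-1 <= spg_diameter Z].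
Proof.
move=> m0 b0 bd md few.
have [colour colP] := colouring_exists m0 b0 bd md few.
apply: (@doubling _ d (b * m) (level m colour) (simplex d m)); rewrite ?muln_gt0 ?m0 ?b0 //.
- lia.
- exact: card_simplex.
- exact: level_simplex.
- exact: level_convex.
Qed.

(** * Choice of the numbers of colours and blocks *)

(** Bernoulli: [(1 + 1 / x) ^ x.+1] is at least [2]. *)
Lemma double_power_le x : 2 * x ^ x.+1 <= x.+1 ^ x.+1.
Proof.
have bernoulli k : (x + k) * x ^ k <= x * x.+1 ^ k.
  elim: k => [|k IH]; first by rewrite addn0.
  rewrite !expnS mulnCA [X in _ <= X]mulnCA.
  apply: leq_trans (leq_mul (leqnn x.+1) IH).
  rewrite !mulnA leq_mul //; nia.
have [->|x0] := posnP x; first by [].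
rewrite -(leq_pmul2l x0); apply: leq_trans (bernoulli x.+1).
by rewrite mulnA leq_mul //; lia.
Qed.

(** With [x = 2 * m - 2], each [x.+1] factors [x.+1 / x] gain a factor [2], and
    [3 * h + 1] doublings pay for [2 * 2 ^ h * m ^ 2]. *)
Lemma few_colours_suffice h m : 0 < m -> m <= 2 ^ h ->
  (2 * m - 1) * (3 * h + 1) <= 2 ^ h - 2 ->
  2 * 2 ^ h * m ^ 2 * (2 * m - 2) ^ (2 ^ h - 2) <= (2 * m - 1) ^ (2 ^ h - 2).
Proof.
move=> m0 mh len; move: len; have -> : 2 * m - 1 = (2 * m - 2).+1 by lia.
move: (2 * m - 2) => x len.
rewrite -(subnKC len); set L := _ * _ in len *.
rewrite (expnD x L) (expnD x.+1 L) mulnA leq_mul //; last first.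
  by case: (_ - L) => [//|k]; rewrite leq_exp2r.
rewrite /L (expnM x) (expnM x.+1).
apply: leq_trans (_ : (2 * x ^ x.+1) ^ (3 * h + 1) <= _); last first.
  by rewrite addn1 leq_exp2r // double_power_le.
have -> : (2 * x ^ x.+1) ^ (3 * h + 1) = 2 * 2 ^ h * (2 ^ h) ^ 2 * (x ^ x.+1) ^ (3 * h + 1).
  by rewrite expnMn -(expnM 2) -(expnS 2 h) -(expnD 2); congr (2 ^ _ * _); lia.
by rewrite leq_mul // leq_mul // leq_exp2r.
Qed.

(** Here [d = 2 ^ h].  Taking [h] itself a power of two makes
    [m = d / (64 * log2 d)] an integer, so that no rounding is needed. *)
Lemma parameters N : exists h m b,
  [/\ N < 2 ^ h, 0 < h, 0 < m, 2 ^ h = 64 * (m * h) & 2 ^ h = 4 * b].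
Proof.
pose g := N + 4; exists (2 ^ g), (2 ^ (2 ^ g - (g + 6))), (2 ^ (2 ^ g - 2)).
have gh : g + 6 <= 2 ^ g by rewrite /g expnD; have := ltn_expl N (isT : 1 < 2); lia.
split; rewrite ?expn_gt0 //.
- by apply: ltn_trans (ltn_expl _ _) => //; rewrite /g in gh; apply: leq_trans gh; lia.
- rewrite -expnD (_ : 64 = 2 ^ 6) // -expnD; congr (_ ^ _); lia.
- rewrite (_ : 4 = 2 ^ 2) // -expnD; congr (_ ^ _); lia.
Qed.

(** * The theorem *)

Import GRing.Theory Num.Theory.
Local Open Scope ring_scope.

Theorem theorem4p24 (R : realType) :
  exists c : R, 0 < c /\
    forall N : nat, exists n : nat,
      [/\ (N < n)%N, (4 %| n)%N &
        exists (X : finType) (Z : subset_partition_graph X (2 * (n %/ 4))),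
          #|X| = (2 * n)%N /\
          layer_family Z /\
          endpoint_count Z /\
          strong_adjacency Z /\
          dimension_reduction Z /\
          c * (n%:R ^+ 2 / ln n%:R) <= (spg_diameter Z)%:R].
Proof.
have ln2_gt0 : 0 < ln (2 : R) by rewrite ln_gt0 // ltr1n.
(* [b * m = d ^ 2 / (256 * h)] layers with [ln n = (h + 2) * ln 2] and
   [n = 4 * d]; the factor [ln 2] cancels, and [8192 = 16 * 512] leaves a
   factor [2] for the difference between layers and diameter *)
exists (ln 2 / 8192); split; first by rewrite divr_gt0.
move=> N; have [h [m [b [Nd h0 m0 dm db]]]] := parameters N.
have mh0 : (0 < m * h)%N by rewrite muln_gt0 m0.
have mmh : (m <= m * h)%N by rewrite leq_pmulr.
have few : (2 * 2 ^ h * m ^ 2 * (2 * m - 2) ^ (2 ^ h - 2)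
         <= (2 * m - 1) ^ (2 ^ h - 2))%N.
  apply: few_colours_suffice => //; first by rewrite dm; lia.
  by rewrite dm mulnDr muln1; nia.
have b16 : (16 <= b)%N by lia.
have [|||Z [lf ec sa dr diam]] := @long_layer_family (2 ^ h) m b m0 _ _ _ few; try lia.
exists (4 * 2 ^ h)%N; split; [lia|exact: dvdn_mulr|].
rewrite mulKn //; exists _, Z; split; first by rewrite !card_prod !card_bool card_ord; lia.
do 4!split=> //.
have -> : ln (4 * 2 ^ h)%:R = (h + 2)%:R * ln (2 : R).
  by rewrite (_ : 4 = 2 ^ 2)%N // -expnD natrX lnXn // mulr_natl addnC.
have -> : ln 2 / 8192 * ((4 * 2 ^ h)%:R ^+ 2 / ((h + 2)%:R * ln 2)) =
          (2 ^ h * 2 ^ h)%:R / (512 * (h + 2))%:R :> R.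
  rewrite !natrM; field.
  by rewrite -natrD pnatr_eq0 addn2 lt0r_neq0.
rewrite ler_pdivrMr; last by rewrite ltr0n; lia.
rewrite -natrM ler_nat.
apply: (@leq_trans ((b * m).-1 * (512 * (h + 2)))%N);
  last by rewrite leq_mul2r diam orbT.
rewrite {1}dm db (_ : 64 * (m * h) * (4 * b) = 256 * (b * m) * h)%N; last by lia.
have : (2 <= b * m)%N by rewrite (leq_trans _ (leq_pmulr b m0)) // (leq_trans _ b16).
by move: (b * m)%N => B B2; clear -B2; nia.
Qed.
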